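(* For any $u_0 \in L^\infty(\mathbb{R})$, the $\omega$-limit set $\omega(u_0)$ contains a constant state or a viscous shock.
   Context: Consider $\partial_t u + f'(u)\partial_x u = \partial_x^2 u$ for $t>0$, $x\in\mathbb{R}$, where $f:\mathbb{R}\to\mathbb{R}$ is smooth with $f''(u)>0$ for all $u\in\mathbb{R}$. For any $u_0\in L^\infty(\mathbb{R})$, $\mathcal{S}_t(u_0)=u(t,\cdot)$ denotes the unique global solution $u\in C^0((0,+\infty),L^\infty(\mathbb{R}))$ with $u(t,\cdot)\to u_0$ weak-$*$ in $L^\infty(\mathbb{R})$ as $t\to0+$. With $(\mathcal{T}_y u)(x)=u(x-y)$, the $\omega$-limit set modulo translations is $$\omega(u_0)=\{v\in L^\infty(\mathbb{R}) \mid \exists\, t_k\to+\infty \text{ and } x_k\in\mathbb{R} \text{ such that } \mathcal{T}_{x_k}\mathcal{S}_{t_k}(u_0)\to v \text{ in } L^\infty_{\mathrm{loc}}(\mathbb{R})\},$$ where convergence in $L^\infty_{\mathrm{loc}}(\mathbb{R})$ is uniform convergence on compact intervals. A constant state is a constant function on $\mathbb{R}$. A viscous shock is a translate $\mathcal{T}_y\phi_{\beta,\alpha}$, $y\in\mathbb{R}$, $\alpha<\beta$, where $\phi_{\beta,\alpha}$ is the unique strictly decreasing solution of $\phi'=f(\phi)-c\phi-d$ with $\phi(-\infty)=\beta$, $\phi(+\infty)=\alpha$, $\phi(0)=(\alpha+\beta)/2$, $c=\frac{f(\beta)-f(\alpha)}{\beta-\alpha}$, $d=f(\beta)-c\beta=f(\alpha)-c\alpha$.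 *)

(* Defs.v *)
From HB Require Import structures.
From mathcomp Require Import all_boot all_order all_algebra.
From mathcomp Require Import all_classical all_reals all_analysis.

Set Implicit Arguments.
Unset Strict Implicit.
Unset Printing Implicit Defensive.
Import Order.TTheory GRing.Theory Num.Theory.
Import numFieldNormedType.Exports.

Local Open Scope ring_scope.
Local Open Scope classical_set_scope.

Definition smooth (R : realType) (f : R -> R) : Prop :=
  forall (n : nat) (x : R), derivable f^`(n) x 1.

(* Elements of L^oo(R) and L^1(R) are handled through representatives. *)
Definition in_Linfty (R : realType) (v : R -> R) : Prop :=
  v \in Lfun (@lebesgue_measure R) +oo%E.

Definition in_L1 (R : realType) (g : R -> R) : Prop :=
  g \in Lfun (@lebesgue_measure R) 1%E.

(* L^oo is the dual of L^1: convergence is tested against integrable g. *)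
Definition weak_star_cvg (R : realType) (F : set_system R)
    (w : R -> R -> R) (w0 : R -> R) : Prop :=
  forall g : R -> R, in_L1 g ->
    (\int[@lebesgue_measure R]_x (w t x * g x)) @[t --> F] -->
    \int[@lebesgue_measure R]_x (w0 x * g x).

(* [u t x] solves u_t + f'(u) u_x = u_xx on (0,+oo) x R in the classical
   sense: the derivatives in the equation exist and are jointly continuous. *)
Definition classical_solution (R : realType) (f : R -> R) (u : R -> R -> R)
    : Prop :=
  forall t x : R, 0 < t ->
  [/\ derivable (u ^~ x) t 1,
      derivable (u t) x 1 &
      derivable (u t)^`() x 1] /\
  [/\ {for (t, x), continuous (fun p : R * R => (u ^~ p.2)^`() p.1)},
      {for (t, x), continuous (fun p : R * R => (u p.1)^`() p.2)} &
      {for (t, x), continuous (fun p : R * R => (u p.1)^`(2) p.2)}] /\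
  (u ^~ x)^`()%classic t + f^`()%classic (u t x) * (u t)^`()%classic x
    = (u t)^`(2)%classic x.

(* [u t] is S_t(u0); the values of [u] at times t <= 0 are irrelevant. *)
Definition solution_from (R : realType) (f u0 : R -> R) (u : R -> R -> R)
    : Prop :=
  [/\ classical_solution f u,
      forall t : R, 0 < t -> in_Linfty (u t),
      forall t : R, 0 < t ->
        Lnorm (@lebesgue_measure R) +oo%E (EFin \o (u s \- u t)) @[s --> t]
          --> 0%E &
      weak_star_cvg 0^'+ u u0].

Definition translate (R : realType) (y : R) (v : R -> R) : R -> R :=
  fun x => v (x - y).

Definition cvg_Linfty_loc (R : realType) (w : nat -> R -> R) (v : R -> R)
    : Prop :=
  forall a b : R, {uniform `[a, b], w k @[k --> \oo] --> v}.

Definition omega_limit (R : realType) (u : R -> R -> R) : set (R -> R) :=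
  [set v | in_Linfty v /\
    exists t_ x_ : nat -> R, t_ k @[k --> \oo] --> +oo /\
      cvg_Linfty_loc (fun k => translate (x_ k) (u (t_ k))) v].

Definition constant_state (R : realType) : set (R -> R) :=
  [set v | exists c : R, v = cst c].

Definition shock_speed (R : realType) (f : R -> R) (beta alpha : R) : R :=
  (f beta - f alpha) / (beta - alpha).

Definition shock_profile (R : realType) (f : R -> R) (beta alpha : R)
    (phi : R -> R) : Prop :=
  let c := shock_speed f beta alpha in
  let d := f beta - c * beta in
  [/\ decreasing_fun phi,
      forall x : R, is_derive x 1 phi (f (phi x) - c * phi x - d),
      phi x @[x --> -oo] --> beta,
      phi x @[x --> +oo] --> alpha &
      phi 0 = (alpha + beta) / 2].

Definition viscous_shock (R : realType) (f : R -> R) : set (R -> R) :=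
  [set v | exists beta alpha y : R, exists phi : R -> R,
    [/\ alpha < beta, shock_profile f beta alpha phi & v = translate y phi]].

(* Main.v *)
Require Import Defs.
From HB Require Import structures.
From mathcomp Require Import all_boot all_order all_algebra.
From mathcomp Require Import all_classical all_reals all_analysis.
From mathcomp Require Import ess_sup_inf.
From mathcomp Require Import ring lra.

(** The limit found is a constant state.  The translations [x_k] are free, so it
    is enough to find, at arbitrarily late times, arbitrarily long windows on
    which [u t] is almost constant; the values taken there are bounded, and
    Bolzano-Weierstrass extracts a limit constant.

    Flat windows exist because [u] is bounded, say by [M], for [t >= 1], and
    almost nonincreasing for large [t].  By boundedness, one of [N] adjacent
    windows of a given length has a drop of at most [2 M / N] from its left end
    to its right end ([bounded_small_drop]).  By the Oleinik-type estimate
    [u t x - u t y <= (A + k (x - y)) / t] for [y <= x] and [t >= 1]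
    ([one_sided_lipschitz]), the solution can rise only by [O(1/t)] inside that
    window, so its oscillation there is small ([flat_windows]).

    The bound and the one-sided estimate both come from one comparison principle
    ([doubled_comparison]).  The usual proof of the Oleinik estimate applies
    the maximum principle to [u_x], which asks for more derivatives than a
    classical solution need have.  Doubling the space variable avoids this: the
    function [u t x - u t y] is compared with a barrier [psi t (x - y)], and at
    a maximum of the difference only first and second derivatives of [u] enter.
    For [psi t r = (2 M + r / m) / t], with [m] a lower bound of [f''] on the
    range of [u], convexity gives
    [(f'(u(x)) - f'(u(y))) psi_r >= m psi psi_r = psi / t = - psi_t],
    which says that [psi] is a supersolution wherever it is exceeded.  The
    constant [2 M] makes [psi] dominate at time [1] without any control of
    [u_x] there. *)

Set Implicit Arguments.
Unset Strict Implicit.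
Unset Printing Implicit Defensive.
Import Order.TTheory GRing.Theory Num.Theory.
Import numFieldNormedType.Exports.

Local Open Scope ring_scope.
Local Open Scope classical_set_scope.

(** * Derivative tests at a maximum *)

(** The difference quotient keeps the sign of its limit; multiplying by [h ^+ 2]
    removes the division and covers both signs of [h]. *)
Lemma difference_sign (R : realType) (g : R -> R) (c d : R) :
  is_derive c 1 g d -> 0 < d ->
  exists2 e : R, 0 < e &
    forall h, h != 0 -> `|h| < e -> 0 < h * (g (c + h) - g c).
Proof.
move=> [dg gd] d0.
have : (h^-1 *: (g (h + c) - g c)) @[h --> 0^'] --> d.
  move: dg; rewrite -gd /derivable /derive /=.
  by under eq_fun do rewrite scaler1.
move/cvgr_gt => /(_ 0 d0).
move=> [e /= e0 he]; exists e => // h h0 he'.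
have := he h; rewrite /= distrC subr0 => /(_ he' h0).
move=> q; have : 0 < h ^+ 2 * (h^-1 * (g (h + c) - g c)).
  by rewrite mulr_gt0 // exprn_even_gt0.
by rewrite mulrA expr2 mulfK // (addrC h c).
Qed.

(** Serves for the time variable, where the maximum may sit at the final time
    and only earlier times are available for comparison. *)
Lemma derive_ge0_at_left_max (R : realType) (g : R -> R) (a c d : R) :
  is_derive c 1 g d -> a < c -> (forall s, a <= s <= c -> g s <= g c) ->
  0 <= d.
Proof.
move=> gd ac gmax; rewrite leNgt; apply/negP => d0.
have [|e e0 he] := @difference_sign R (- g) c (- d) (is_deriveN gd).
  by rewrite oppr_gt0.
pose h := Num.min (e / 2) (c - a).
have h0 : 0 < h by rewrite lt_min subr_gt0 ac divr_gt0.
have he2 : h <= e / 2 by rewrite ge_min lexx.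
have hca : h <= c - a by rewrite ge_min lexx orbT.
have := he (- h); rewrite oppr_eq0 gt_eqF// normrN gtr0_norm// => /(_ isT).
have := gmax (c - h); rewrite /=.
have -> : a <= c - h <= c by lra.
move=> /(_ isT) q /(_ ltac:(lra)).
by rewrite mulNr oppr_gt0 pmulr_rlt0 // !fctE; lra.
Qed.

(** If [ddg] were positive, [dg] would be positive just to the right of its zero
    [c], and [g] would increase there. *)
Lemma derivative_test_at_max (R : realType) (g dg : R -> R) (c ddg : R) :
  (forall x : R, is_derive x 1 g (dg x)) -> is_derive c 1 dg ddg ->
  (\forall x \near c, g x <= g c) -> dg c = 0 /\ ddg <= 0.
Proof.
move=> g1 g2 [e /= e0 gmax].
have near_c x : `|x - c| < e -> g x <= g c.
  by move=> xe; apply: gmax; rewrite /= distrC.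
have dg0 : dg c = 0.
  have [] := @derive1_at_max R g (c - e) (c + e) c.
  - by lra.
  - by move=> t _; have [] := g1 t.
  - by rewrite in_itv /=; lra.
  - move=> t; rewrite in_itv /= => /andP[t1 t2]; apply: near_c.
    by rewrite ltr_norml; lra.
  - by move=> _; have [_ ->] := g1 c.
split => //; rewrite leNgt; apply/negP => ddg0.
have [r r0 hr] := difference_sign g2 ddg0.
pose h := Num.min (e / 2) (r / 2).
have h0 : 0 < h by rewrite lt_min !divr_gt0.
have he2 : h <= e / 2 by rewrite ge_min lexx.
have hr2 : h <= r / 2 by rewrite ge_min lexx orbT.
have [||z] := @MVT R g dg c (c + h).
- by lra.
- apply: continuous_subspaceT => x; apply: differentiable_continuous.
  by apply/derivable1_diffP; have [] := g1 x.
rewrite in_itv /= => /andP[z1 z2] gz.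
have := near_c (c + h); rewrite addrAC subrr add0r gtr0_norm //.
move=> /(_ ltac:(lra)).
have := hr (z - c); rewrite gtr0_norm ?subr_gt0// subr_eq0 gt_eqF// => /(_ isT).
move=> /(_ ltac:(lra)); rewrite [c + _]addrC subrK dg0 subr0.
rewrite pmulr_rgt0 ?subr_gt0 // => dgz.
have : 0 < dg z * (c + h - c) by rewrite mulr_gt0 //; lra.
by rewrite -gz; lra.
Qed.

Lemma is_derive_sub_quadratic (R : realType) (h : R -> R) (dh a b e x : R) :
  is_derive x 1 h dh ->
  is_derive x 1 (fun z => h z - (a + b * z + e * z ^+ 2))
    (dh - (b + 2 * e * x)).
Proof.
move=> hdh.
have dX : is_derive x 1 (id : R -> R) 1 by exact: is_derive_id.
have dl : is_derive x 1 (cst a + b *: (id : R -> R)) (0 + b *: 1).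
  by apply: is_deriveD; apply: is_deriveZ.
have dp := is_deriveD dl (is_deriveZ e (is_deriveM dX dX)).
have -> : b + 2 * e * x = 0 + b *: 1 + e *: (x *: 1 + x *: 1).
  by rewrite /GRing.scale /= !mulr1; ring.
exact: (is_deriveB hdh dp).
Qed.

Lemma is_derive_sub_affine (R : realType) (h : R -> R) (dh a b x : R) :
  is_derive x 1 h dh ->
  is_derive x 1 (fun z => h z - (a + b * z)) (dh - b).
Proof.
move=> hdh.
have -> : (fun z => h z - (a + b * z)) =
    (fun z => h z - (a + b * z + 0 * z ^+ 2)).
  by apply/funext => z; rewrite mul0r addr0.
have -> : dh - b = dh - (b + 2 * 0 * x) by rewrite mulr0 mul0r addr0.
exact: is_derive_sub_quadratic.
Qed.

Lemma is_derive_expR_scale (R : realType) (l d x : R) :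
  is_derive x 1 (fun z => d * expR (l * z)) (l * (d * expR (l * x))).
Proof.
have -> : (fun z => d * expR (l * z)) = d *: (expR \o (l *: id)).
  by apply/funext.
apply: is_derive_eq; rewrite /GRing.scale /=; ring.
Qed.

(** The form in which the test meets the penalized function: in each space
    variable, barrier plus penalty is a quadratic polynomial. *)
Lemma sub_quadratic_test_at_max (R : realType) (h h1 : R -> R)
    (a b e x h2 : R) :
  (forall z : R, is_derive z 1 h (h1 z)) -> is_derive x 1 h1 h2 ->
  (\forall z \near x,
     h z - (a + b * z + e * z ^+ 2) <= h x - (a + b * x + e * x ^+ 2)) ->
  h1 x = b + 2 * e * x /\ h2 <= 2 * e.
Proof.
move=> dh dh1 hmax.
have [||] := @derivative_test_at_max R _ (fun z => h1 z - (b + 2 * e * z)) x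
  (h2 - 2 * e) _ _ hmax.
- by move=> z; exact: is_derive_sub_quadratic.
- exact: is_derive_sub_affine.
- by lra.
Qed.

(** * Comparison with two space variables *)

(** The equation [v_t + b v_x = v_xx] with the drift [b] as a given function: in
    this linear form [u], [- u] and [0] can all be compared. *)
Definition advection_diffusion (R : realType) (b v : R -> R -> R) : Prop :=
  exists vt vx vxx : R -> R -> R, forall t x : R, 0 < t ->
  [/\ is_derive t 1 (v ^~ x) (vt t x), is_derive x 1 (v t) (vx t x),
      is_derive x 1 (vx t) (vxx t x) & vt t x + b t x * vx t x = vxx t x].

Definition jointly_continuous (R : realType) (v : R -> R -> R) : Prop :=
  forall t x : R, 0 < t ->
    {for (t, x), continuous (fun p : R * R => v p.1 p.2)}.

Definition strip_bounded (R : realType) (T B : R) (v : R -> R -> R) : Prop :=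
  forall t x : R, 1 <= t <= T -> `|v t x| <= B.

(** This quantity is [(p_t + b p_x + c p_y - p_xx - p_yy) / P] for the penalty
    [p = P (1 + x^2 + y^2)] with [P = d exp((2 K + 5) t)], so the penalty is a
    strict supersolution for all drifts bounded by [K]. *)
Lemma penalty_strict (R : realType) (K b c x y : R) : `|b| <= K -> `|c| <= K ->
  0 < (2 * K + 5) * (1 + x ^+ 2 + y ^+ 2) + 2 * b * x + 2 * c * y - 4.
Proof.
move=> bK cK.
have K0 : 0 <= K by exact: le_trans bK.
have cross (d z : R) : `|d| <= K -> - (K * (1 + z ^+ 2)) <= 2 * d * z.
  rewrite ler_norml => /andP[d1 d2].
  have := sqr_ge0 (z + 1); have := sqr_ge0 (z - 1).
  by case: (leP 0 z) => z0; nra.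
have := cross b x bK; have := cross c y cK.
have := sqr_ge0 x; have := sqr_ge0 y.
by nra.
Qed.

(** A maximum over an unbounded domain, attained because the values at distance
    [M] and beyond stay below one value of [F]. *)
Lemma doubled_max (R : realType) (T M : R)
    (D : set (R * R)) (F : R -> R -> R -> R) (t0 x0 y0 : R) :
  closed D ->
  (forall t x y, 1 <= t ->
    {for (t, (x, y)), continuous (fun p : R * (R * R) => F p.1 p.2.1 p.2.2)}) ->
  1 <= t0 <= T -> D (x0, y0) ->
  (forall t x y, 1 <= t <= T -> D (x, y) ->
     M <= `|x| \/ M <= `|y| -> F t x y < F t0 x0 y0) ->
  exists t x y, [/\ 1 <= t <= T, D (x, y), `|x| < M /\ `|y| < M,
    F t0 x0 y0 <= F t x y &
    forall t' x' y', 1 <= t' <= T -> D (x', y') -> F t' x' y' <= F t x y].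
Proof.
move=> Dcl Fc t0T D0 far.
pose Q : set (R * (R * R)) := `[1, T] `*` ((`[- M, M] `*` `[- M, M]) `&` D).
have M0 : `|x0| < M /\ `|y0| < M.
  by split; rewrite ltNge; apply/negP => h; have := far _ _ _ t0T D0;
    rewrite ltxx; [move=> /(_ (or_introl h))|move=> /(_ (or_intror h))].
have QP t x y : 1 <= t <= T -> D (x, y) -> `|x| < M /\ `|y| < M ->
    Q (t, (x, y)).
  move=> tT Dxy [xM yM]; split => /=; first by rewrite in_itv.
  by split => //; split; rewrite /= in_itv /= -ler_norml ltW.
have Q0 : Q (t0, (x0, y0)) by exact: QP.
have cQ : compact Q.
  apply: compact_setX; first exact: segment_compact.
  by apply: compact_closedI => //; apply: compact_setX; exact: segment_compact.
have [||[t [x y]] /set_mem[/= tT [xyM Dxy]] Fmax] :=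
  @compact_EVT_max _ R (fun p : R * (R * R) => F p.1 p.2.1 p.2.2) Q _ cQ.
- by exists (t0, (x0, y0)).
- apply: continuous_in_subspaceT => -[t [x y]] /set_mem[/= tT _].
  by apply: Fc; move: tT; rewrite in_itv /= => /andP[].
move: tT; rewrite in_itv /= => tT.
have F0 : F t0 x0 y0 <= F t x y.
  by have := Fmax (t0, (x0, y0)); rewrite inE; exact.
exists t, x, y; split => //.
  by split; rewrite ltNge; apply/negP => h; have := far _ _ _ tT Dxy;
    rewrite ltNge F0; [move=> /(_ (or_introl h))|move=> /(_ (or_intror h))].
move=> t' x' y' t'T Dxy'.
have [near0|far0] := pselect (`|x'| < M /\ `|y'| < M).
  by have := Fmax (t', (x', y')); rewrite inE; apply; exact: QP.
apply/ltW/(lt_le_trans _ F0)/far => //.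
case: (leP M `|x'|) => [|xM]; first by left.
by right; rewrite leNgt; apply/negP => yM; exact: far0.
Qed.

(** If [v + w] exceeded the barrier [psi], it would still exceed [psi] plus a
    small penalty tending to infinity in space, hence [v + w - psi - penalty]
    would have a positive maximum.  There the derivative tests turn the two
    equations into an inequality that contradicts the supersolution property,
    because the penalty satisfies it strictly.  As [psi] is affine in
    [x - y], its second derivatives vanish and the tests in [x] and [y] can be
    made separately.  The supersolution property and the interiority in [D] are
    asked only where [psi] is exceeded, as they use this excess. *)
Lemma doubled_comparison (R : realType) (T K B : R) (b c v w : R -> R -> R)
    (D : set (R * R)) (alpha beta dalpha dbeta : R -> R) :
  let psi t r := alpha t + beta t * r in
  advection_diffusion b v -> advection_diffusion c w ->
  jointly_continuous v -> jointly_continuous w ->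
  strip_bounded T B v -> strip_bounded T B w ->
  strip_bounded T K b -> strip_bounded T K c ->
  closed D ->
  (forall t : R, 1 <= t -> is_derive t 1 alpha (dalpha t)) ->
  (forall t : R, 1 <= t -> is_derive t 1 beta (dbeta t)) ->
  (forall t x y, 1 <= t <= T -> D (x, y) -> 0 <= psi t (x - y)) ->
  (forall x y, D (x, y) -> v 1 x + w 1 y <= psi 1 (x - y)) ->
  (forall t x y, 1 <= t <= T -> D (x, y) -> psi t (x - y) < v t x + w t y ->
     nbhs (x, y) D /\
     0 <= dalpha t + dbeta t * (x - y) + (b t x - c t y) * beta t) ->
  forall t x y, 1 <= t <= T -> D (x, y) -> v t x + w t y <= psi t (x - y).
Proof.
move=> psi [vt [vx [vxx Hv]]] [wt [wx [wxx Hw]]] vc wc vB wB bK cK Dcl da db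
  psi0 init super t0 x0 y0 t0T D0.
rewrite leNgt; apply/negP => gap.
pose lam := 2 * K + 5.
pose P t := expR (lam * t).
have P0 t : 0 < P t by exact: expR_gt0.
pose q x y : R := 1 + x ^+ 2 + y ^+ 2.
have q1 x y : 1 <= q x y.
  by rewrite /q; have := sqr_ge0 x; have := sqr_ge0 y; lra.
(* The penalty uses up half of the excess at the given point. *)
pose d := (v t0 x0 + w t0 y0 - psi t0 (x0 - y0)) / (2 * (P t0 * q x0 y0)).
have q00 : 0 < P t0 * q x0 y0 by rewrite mulr_gt0 //; have := q1 x0 y0; lra.
have d0 : 0 < d by rewrite divr_gt0 ?subr_gt0 // mulr_gt0.
pose E t := d * P t.
have E0 t : 0 < E t by rewrite mulr_gt0.
pose F t x y := v t x + w t y - psi t (x - y) - E t * q x y.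
have F0 : 0 < F t0 x0 y0.
  have : d * (2 * (P t0 * q x0 y0)) = v t0 x0 + w t0 y0 - psi t0 (x0 - y0).
    by rewrite /d divfK // gt_eqF // mulr_gt0.
  by rewrite /F /E => e; have := mulr_gt0 d0 q00; rewrite -e; lra.
have Fc t x y : 1 <= t ->
    {for (t, (x, y)), continuous (fun p : R * (R * R) => F p.1 p.2.1 p.2.2)}.
  move=> t1; have tp : 0 < t by lra.
  have c1 : (fun p : R * (R * R) => p.1) @ (t, (x, y)) --> t by exact: cvg_fst.
  have c21 : (fun p : R * (R * R) => p.2.1) @ (t, (x, y)) --> x.
    exact: (cvg_comp _ _ cvg_snd cvg_fst).
  have c22 : (fun p : R * (R * R) => p.2.2) @ (t, (x, y)) --> y.
    exact: (cvg_comp _ _ cvg_snd cvg_snd).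
  have cd (g : R -> R) dg : is_derive t 1 g dg ->
      (fun p : R * (R * R) => g p.1) @ (t, (x, y)) --> g t.
    move=> [g1 _]; have gc : {for t, continuous g}.
      by apply: differentiable_continuous; apply/derivable1_diffP.
    exact: (cvg_comp _ _ c1 gc).
  have cv : (fun p : R * (R * R) => v p.1 p.2.1) @ (t, (x, y)) --> v t x.
    exact: (cvg_comp _ _ (cvg_pair c1 c21) (vc t x tp)).
  have cw : (fun p : R * (R * R) => w p.1 p.2.2) @ (t, (x, y)) --> w t y.
    exact: (cvg_comp _ _ (cvg_pair c1 c22) (wc t y tp)).
  have cE := cd _ _ (is_derive_expR_scale lam d t).
  rewrite /F /psi /q; apply: cvgB.
    apply: cvgB; first exact: cvgD.
    apply: cvgD; first exact: cd (da t t1).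
    by apply: cvgM; [exact: cd (db t t1)|exact: cvgB].
  apply: cvgM => //; apply: cvgD; last exact: cvgM.
  by apply: cvgD; [exact: cvg_cst|exact: cvgM].
have K0 : 0 <= K by apply: le_trans (bK t0 x0 t0T); exact: normr_ge0.
have E_ge t : 1 <= t <= T -> d <= E t.
  move=> /andP[t1 _]; apply: ler_peMr; first exact: ltW.
  by rewrite /P -expR0 ler_expR mulr_ge0 /lam //; lra.
have B0 : 0 <= B by apply: le_trans (vB t0 x0 t0T); exact: normr_ge0.
(* Beyond [M] the penalty outweighs [v + w], which is at most [2 * B]. *)
pose M := 2 * B / d + 1.
have M1 : 1 <= M.
  by rewrite /M lerDr; apply: divr_ge0; [rewrite mulr_ge0|exact: ltW].
have far t x y : 1 <= t <= T -> D (x, y) ->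
    M <= `|x| \/ M <= `|y| -> F t x y < F t0 x0 y0.
  move=> tT Dxy xyM; apply: le_lt_trans F0.
  have := psi0 t x y tT Dxy; have := vB t x tT; have := wB t y tT.
  rewrite !ler_norml => /andP[_ w1] /andP[_ v1] p1.
  have Mq : M <= q x y.
    have sq z : M <= `|z| -> M <= z ^+ 2.
      by rewrite -(real_normK (num_real z)) => h; nra.
    rewrite /q; have := sqr_ge0 x; have := sqr_ge0 y.
    by case: xyM => /sq; lra.
  have dM : 2 * B <= d * M.
    by rewrite /M mulrDr mulr1 [d * (_ / _)]mulrC divfK ?gt_eqF //; lra.
  have : d * M <= E t * q x y by apply: ler_pM => //; [lra|lra|exact: E_ge].
  by rewrite /F; lra.
have [t [x [y [tT Dxy [xM yM] FF Fmax]]]] :=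
  @doubled_max R T M D F t0 x0 y0 Dcl Fc t0T D0 far.
have Ftop : 0 < F t x y by exact: lt_le_trans FF.
have above : psi t (x - y) < v t x + w t y.
  have : 0 < E t * q x y by rewrite mulr_gt0 //; have := q1 x y; lra.
  by move: Ftop; rewrite /F; lra.
have [t1 t2] := andP tT.
have tgt1 : 1 < t.
  rewrite lt_neqAle t1 andbT; apply/eqP => te.
  by have := init x y Dxy; move: above; rewrite -te; lra.
have tp : 0 < t by lra.
have [nD sup] := super t x y tT Dxy above.
have [_ hvx hvxx ev] := Hv t x tp.
have [_ hwx hwxx ew] := Hw t y tp.
(* The quadratic polynomial collects the terms of [F] that depend on the tested
   variable; its constant absorbs the rest. *)
have [xd xdd] : vx t x = (beta t) + 2 * E t * x /\ vxx t x <= 2 * E t.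
  apply: (@sub_quadratic_test_at_max R (v t) (vx t)
    (alpha t - beta t * y - w t y + E t * (1 + y ^+ 2))).
  - by move=> z; have [] := Hv t z tp.
  - have : \forall z \near x, D (z, y).
      exact: (cvg_pair (@cvg_id _ (nbhs x)) (cvg_cst y) nD).
    apply: filterS => z Dz; have := Fmax t z y tT Dz.
    by rewrite /F /psi /q; lra.
have [yd ydd] : wx t y = (- beta t) + 2 * E t * y /\ wxx t y <= 2 * E t.
  apply: (@sub_quadratic_test_at_max R (w t) (wx t)
    (alpha t + beta t * x - v t x + E t * (1 + x ^+ 2))).
  - by move=> z; have [] := Hw t z tp.
  - have : \forall z \near y, D (x, z).
      exact: (cvg_pair (cvg_cst x) (@cvg_id _ (nbhs y)) nD).
    apply: filterS => z Dz; have := Fmax t x z tT Dz.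
    by rewrite /F /psi /q; lra.
have td : 0 <= vt t x + wt t y
    - (dalpha t + (x - y) * dbeta t) - q x y * (lam * E t).
  apply: (@derive_ge0_at_left_max R (fun s => F s x y) 1 t).
  - have -> : (fun s => F s x y) = (v ^~ x) + (w ^~ y)
       - (alpha + (x - y) *: beta) - (q x y) *: E.
      by apply/funext => s; rewrite /F /psi !fctE /GRing.scale /=; ring.
    have dv : is_derive t 1 (v ^~ x) (vt t x) by have [] := Hv t x tp.
    have dw : is_derive t 1 (w ^~ y) (wt t y) by have [] := Hw t y tp.
    have dE : is_derive t 1 E (lam * E t) := is_derive_expR_scale lam d t.
    have da' : is_derive t 1 alpha (dalpha t) := da t t1.
    have db' : is_derive t 1 beta (dbeta t) := db t t1.
    exact: (is_deriveB (is_deriveB (is_deriveD dv dw)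
      (is_deriveD da' (is_deriveZ (x - y) db'))) (is_deriveZ (q x y) dE)).
  - by [].
  - by move=> s /andP[s1 s2]; apply: Fmax => //; rewrite s1 /=; lra.
have := penalty_strict x y (bK t x tT) (cK t y tT).
rewrite -/lam => pen; have := mulr_gt0 (E0 t) pen.
move: td ev ew; rewrite xd yd /q => td ev ew.
by lra.
Qed.

(** * Regularity of solutions *)

Lemma is_derive_derive1 (R : realType) (g : R -> R) (x : R) :
  derivable g x 1 -> is_derive x 1 g (g^`()%classic x).
Proof. by move=> dg; rewrite derive1E; exact: derivableP. Qed.

Lemma derivable_continuous (R : realType) (g : R -> R) :
  (forall x : R, derivable g x 1) -> continuous g.
Proof.
by move=> dg x; apply/differentiable_continuous/derivable1_diffP; exact: dg.
Qed.

Lemma solution_advection_diffusion (R : realType) (f : R -> R) u :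
  classical_solution f u ->
  advection_diffusion (fun t x => f^`()%classic (u t x)) u.
Proof.
move=> sol; exists (fun t x => (u ^~ x)^`()%classic t),
  (fun t x => (u t)^`()%classic x), (fun t x => (u t)^`(2)%classic x).
move=> t x t0; have [[d1 d2 d3] [_ e]] := sol t x t0.
split; [exact: is_derive_derive1|exact: is_derive_derive1| |exact: e].
exact: (is_derive_derive1 d3).
Qed.

Lemma advection_diffusionN (R : realType) (b v : R -> R -> R) :
  advection_diffusion b v -> advection_diffusion b (fun t x => - v t x).
Proof.
move=> [vt [vx [vxx H]]].
exists (fun t x => - vt t x), (fun t x => - vx t x), (fun t x => - vxx t x).
move=> t x t0; have [d1 d2 d3 e] := H t x t0.
split; [exact: is_deriveN|exact: is_deriveN|exact: is_deriveN|].
by rewrite -e; lra.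
Qed.

Lemma advection_diffusion0 (R : realType) (b : R -> R -> R) :
  advection_diffusion b (fun=> fun=> 0).
Proof.
exists (fun=> fun=> 0), (fun=> fun=> 0), (fun=> fun=> 0) => t x t0.
split; [exact: is_derive_cst|exact: is_derive_cst|exact: is_derive_cst|].
by lra.
Qed.

Lemma solution_continuous_x (R : realType) (f : R -> R) u (t : R) :
  classical_solution f u -> 0 < t -> continuous (u t).
Proof.
move=> sol t0; apply: derivable_continuous => x.
by have [[]] := sol t x t0.
Qed.

(** Near [(t, x)] the time derivative is bounded, being jointly continuous, so
    [u] is Lipschitz in time uniformly in space; continuity of [u t] does the
    rest. *)
Lemma solution_jointly_continuous (R : realType) (f : R -> R) u :
  classical_solution f u -> jointly_continuous u.
Proof.
move=> sol t x t0.
have [_ [[ct _ _] _]] := sol t x t0.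
pose L := `|(u ^~ x)^`()%classic t| + 1.
have L0 : 0 < L by rewrite /L ltr_wpDl.
have : \forall p \near (t, x), `|(u ^~ p.2)^`()%classic p.1| < L.
  have : `|(u ^~ p.2)^`()%classic p.1| @[p --> (t, x)] -->
      `|(u ^~ x)^`()%classic t|.
    exact: (cvg_norm ct).
  by move/cvgr_lt; apply; rewrite /L ltrDl.
move=> [[A1 A2] /= [[e1 /= e10 B1] [e2 /= e20 B2]] AL].
have lip s y : 0 < s -> `|t - s| < e1 -> `|x - y| < e2 ->
    `|u s y - u t y| <= L * `|s - t|.
  move=> s0 ts xy.
  have yA : A2 y by exact: B2.
  have key a b : 0 < a -> a <= b -> `|t - a| < e1 -> `|t - b| < e1 ->
      `|u b y - u a y| <= L * `|b - a|.
    move=> a0 ab ta tb.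
    have dz z : a <= z -> derivable (u ^~ y) z 1.
      by move=> az; have [[]] := sol z y (lt_le_trans a0 az).
    have [||z] := @MVT_segment R (u ^~ y) ((u ^~ y)^`()%classic) a b ab.
    - move=> z; rewrite in_itv /= => /andP[az _].
      exact/is_derive_derive1/dz/ltW.
    - apply: derivable_within_continuous => z; rewrite in_itv /= => /andP[az _].
      exact: dz.
    rewrite in_itv /= => /andP[az zb] ->.
    rewrite normrM ler_wpM2r //; apply/ltW/(AL (z, y)); split => //=.
    apply: B1 => /=; move: ta tb; rewrite !ltr_norml => /andP[? ?] /andP[? ?].
    by lra.
  have tt : `|t - t| < e1 by rewrite subrr normr0.
  have [st|/ltW ts'] := leP t s; first exact: key.
  by rewrite distrC (distrC s); exact: key.
have cx : u t y @[y --> x] --> u t x := solution_continuous_x sol t0 (x := x).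
apply/cvgrPdist_le => /= eps eps0.
have e2eps : 0 < eps / 2 by rewrite divr_gt0.
have n1 : \forall p \near (t, x), `|u t x - u t p.2| <= eps / 2.
  have : u t p.2 @[p --> (t, x)] --> u t x.
    have c2 : (fun p : R * R => p.2) @ (t, x) --> x by exact: cvg_snd.
    exact: (cvg_comp _ _ c2 cx).
  by move/cvgrPdist_le; exact.
have c1 : (fun p : R * R => p.1) @ (t, x) --> t by exact: cvg_fst.
have c2 : (fun p : R * R => p.2) @ (t, x) --> x by exact: cvg_snd.
have n2 : \forall p \near (t, x), `|t - p.1| < e1.
  by move/cvgrPdist_lt: c1; exact.
have n3 : \forall p \near (t, x), `|x - p.2| < e2.
  by move/cvgrPdist_lt: c2; exact.
have n4 : \forall p \near (t, x), 0 < p.1 by move/cvgr_gt: c1; exact.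
have n5 : \forall p \near (t, x), `|t - p.1| < eps / 2 / L.
  by move/cvgrPdist_lt: c1; apply; rewrite divr_gt0.
near=> p.
have p1 : `|u t x - u t p.2| <= eps / 2 by near: p.
have p2 : `|t - p.1| < e1 by near: p.
have p3 : `|x - p.2| < e2 by near: p.
have p4 : 0 < p.1 by near: p.
have p5 : `|t - p.1| < eps / 2 / L by near: p.
have := lip p.1 p.2 p4 p2 p3; rewrite distrC (distrC p.1 t) => p6.
move: p5; rewrite ltr_pdivlMr // mulrC => p5.
have := ler_distD (u t p.2) (u t x) (u p.1 p.2).
by lra.
Unshelve. all: by end_near. Qed.

(** * Pointwise bounds from essential bounds *)

(** A violation would occur on a whole ball, which has positive measure. *)
Lemma ae_le_continuous (R : realType) (g : R -> R) (B : R) :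
  continuous g -> (\forall x \ae (@lebesgue_measure R), g x <= B) ->
  forall x, g x <= B.
Proof.
move=> gc [N [mN N0 gN]] x; rewrite leNgt; apply/negP => Bx.
have : \forall y \near x, B < g y by have := gc x; move/cvgr_gt; exact.
move=> [e /= e0 he].
have sub : ball x e `<=` N.
  by move=> y /he By; apply: gN => /=; apply/negP; rewrite -ltNge.
have : (lebesgue_measure (ball x e) <= @lebesgue_measure R N)%E.
  by apply: le_measure; rewrite // inE // ball_itv; exact: measurable_itv.
rewrite N0 lebesgue_measure_ball ?(ltW e0) //.
by apply/negP; rewrite -ltNge lte_fin mulrn_wgt0.
Qed.

Lemma lebesgue_setT_gt0 (R : realType) : (0 < @lebesgue_measure R [set: R])%E.
Proof.
by rewrite -set_itvNyy lebesgue_measure_itv /= ?ltNyr ?ltry.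
Qed.

Lemma Lnormy_le_continuous (R : realType) (g : R -> R) (B : R) :
  continuous g -> (Lnorm (@lebesgue_measure R) +oo (EFin \o g) <= B%:E)%E ->
  forall x, `|g x| <= B.
Proof.
move=> gc; rewrite unlock /Lnorm lebesgue_setT_gt0 => /ess_supP gB.
apply: (@ae_le_continuous _ (fun x => `|g x|)).
  by move=> x; apply: cvg_norm; exact: gc.
by apply: filterS gB => x /=; rewrite lee_fin.
Qed.

Lemma in_Linfty_bounded (R : realType) (g : R -> R) :
  continuous g -> in_Linfty g -> exists B : R, forall x, `|g x| <= B.
Proof.
move=> gc; rewrite /in_Linfty inE => /andP[_].
rewrite inE /= /finite_norm => gy.
have g0 := Lnorm_ge0 (@lebesgue_measure R) +oo%E (EFin \o g).
exists (fine (Lnorm (@lebesgue_measure R) +oo (EFin \o g))).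
apply: Lnormy_le_continuous => //.
by rewrite fineK // ge0_fin_numE.
Qed.

(** The bound may depend on [T]: each time has a neighbourhood on which the
    sup norm varies by at most 1, and [[1, T]] is compact.  The comparison
    principle needs such a bound before it can give one uniform in time. *)
Lemma solution_strip_bounded (R : realType) (f u0 : R -> R) u (T : R) :
  solution_from f u0 u -> exists B : R, strip_bounded T B u.
Proof.
move=> [sol Loo cont _].
have cvr : near_covering `[1, T].
  by apply/compact_near_coveringP; exact: segment_compact.
have := cvr R (pinfty_nbhs R) (fun B t => forall x, `|u t x| <= B).
move=> /(_ _)[|M [_ MT]].
  move=> t /=; rewrite in_itv /= => /andP[t1 _].
  have t0 : 0 < t by lra.
  have cu (s : R) : 0 < s -> continuous (u s).
    exact: solution_continuous_x sol.
  have [B uB] := in_Linfty_bounded (cu t t0) (Loo t t0).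
  have near1 : \forall s \near t, forall x, `|u s x| <= B + 1.
    have pos : \forall s \near t, 0 < s.
      by have := @cvg_id _ (nbhs t); move/cvgr_gt; exact.
    have : \forall s \near t,
        (Lnorm (@lebesgue_measure R) +oo (EFin \o (u s \- u t)%R) < 1%:E)%E.
      have lt1 : nbhs (0%E : \bar R) [set y | (y < 1%:E)%E].
        by apply: open_ereal_lt'; rewrite lte_fin.
      exact: (cont t t0 _ lt1).
    apply: filterS2 pos => s s0 /ltW su x.
    have cs : continuous (u s \- u t).
      by move=> y; apply: cvgB; exact: cu.
    have := Lnormy_le_continuous cs su x; rewrite /= => h.
    have := ler_normD (u s x - u t x) (u t x); rewrite subrK.
    by have := uB x; lra.
  exists ([set s | forall x, `|u s x| <= B + 1], [set M | B + 1 <= M]).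
    by split => /=; [exact: near1|apply: nbhs_pinfty_ge; exact: num_real].
  move=> [s M] [/= su BM] x; apply: (le_trans (su x)); exact: BM.
exists (M + 1) => t x tT; apply: (MT (M + 1)); first by rewrite ltrDl.
by rewrite /= in_itv.
Qed.

(** * A priori estimates *)

Lemma continuous_bounded_ball (R : realType) (g : R -> R) (M : R) :
  continuous g -> exists K : R, forall r, `|r| <= M -> `|g r| <= K.
Proof.
move=> gc; have [M0|M0] := leP 0 M; last first.
  by exists 0 => r /le_lt_trans /(_ M0); rewrite ltNge normr_ge0.
have [||c _ cmax] := @EVT_max R (fun r => `|g r|) (- M) M.
- by lra.
- by apply: continuous_subspaceT => r; apply: cvg_norm; exact: gc.
by exists `|g c| => r rM; apply: cmax; rewrite in_itv /= -ler_norml.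
Qed.

Lemma continuous_gt0_ball (R : realType) (g : R -> R) (M : R) :
  continuous g -> (forall r, 0 < g r) ->
  exists2 m : R, 0 < m & forall r, `|r| <= M -> m <= g r.
Proof.
move=> gc g0; have [M0|M0] := leP 0 M; last first.
  by exists 1 => // r /le_lt_trans /(_ M0); rewrite ltNge normr_ge0.
have [||c _ cmin] := @EVT_min R g (- M) M.
- by lra.
- by apply: continuous_subspaceT => r; exact: gc.
by exists (g c) => // r rM; apply: cmin; rewrite in_itv /= -ler_norml.
Qed.

Lemma smooth_continuous (R : realType) (f : R -> R) (n : nat) :
  smooth f -> continuous f^`(n)%classic.
Proof. by move=> fs; apply: derivable_continuous => x; exact: fs. Qed.

(** The doubled comparison in which the second function and the slope of the
    barrier vanish. *)
Lemma maximum_principle (R : realType) (T K B M : R) (b v : R -> R -> R) :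
  advection_diffusion b v -> jointly_continuous v ->
  strip_bounded T B v -> strip_bounded T K b ->
  0 <= M -> (forall x, v 1 x <= M) ->
  forall t x, 1 <= t <= T -> v t x <= M.
Proof.
move=> Hv vc vB bK M0 vM t x tT.
have B0 : 0 <= B by apply: le_trans (vB t x tT); exact: normr_ge0.
have := @doubled_comparison R T K B b b v (fun=> fun=> 0) setT (cst M) (cst 0)
  (cst 0) (cst 0) Hv (advection_diffusion0 b) vc.
rewrite /=.
have c0 : jointly_continuous (fun _ _ : R => 0 : R).
  by move=> s y _; exact: cvg_cst.
move=> /(_ c0 vB _ bK bK (@closedT _)) H.
have := H _ _ _ _ _ _ t x x tT I; rewrite mul0r !addr0; apply.
- by move=> s y _; rewrite normr0.
- by move=> s y z _ _; rewrite mul0r addr0.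
- by move=> y z _; rewrite mul0r !addr0.
- move=> s y z _ _ _; split; first exact: filterT.
  by rewrite mulr0 mul0r !addr0.
Qed.

Lemma solution_uniformly_bounded (R : realType) (f u0 : R -> R) u :
  smooth f -> solution_from f u0 u ->
  exists2 M : R, 0 < M & forall t x : R, 1 <= t -> `|u t x| <= M.
Proof.
move=> fs us; have [sol _ _ _] := us.
have [M1 uM1] := solution_strip_bounded 1 us.
have M10 : 0 <= M1 by apply: le_trans (uM1 1 0 _); rewrite ?normr_ge0 ?lexx.
exists (M1 + 1); first by lra.
move=> t x t1.
have [B uB] := solution_strip_bounded t us.
have [K fK] := continuous_bounded_ball B (smooth_continuous (n := 1) fs).
have bK : strip_bounded t K (fun s y => f^`()%classic (u s y)).
  by move=> s y st; apply: fK; exact: uB.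
have tt : 1 <= t <= t by rewrite t1 lexx.
have adv := solution_advection_diffusion sol.
have uc := solution_jointly_continuous sol.
have u1 y : `|u 1 y| <= M1 by apply: uM1; rewrite lexx.
have up : u t x <= M1.
  apply: (@maximum_principle R t K B M1 _ u adv uc uB bK M10 _ t x tt) => y.
  by have := u1 y; rewrite ler_norml => /andP[].
have un : - u t x <= M1.
  have uNc : jointly_continuous (fun s y => - u s y).
    by move=> s y s0; apply: cvgN; exact: uc.
  have uNB : strip_bounded t B (fun s y => - u s y).
    by move=> s y st; rewrite normrN; exact: uB.
  apply: (@maximum_principle R t K B M1 _ _ (advection_diffusionN adv) uNc
    uNB bK M10 _ t x tt) => y.
  by have := u1 y; rewrite ler_norml => /andP[]; lra.
by rewrite ler_norml; lra.
Qed.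

Lemma is_derive_div_id (R : realType) (A t : R) : 0 < t ->
  is_derive t 1 (fun s => A / s) (- (A / t ^+ 2)).
Proof.
move=> t0; have tn : t != 0 by rewrite gt_eqF.
have -> : (fun s => A / s) = A *: (fun s : R => s^-1) by apply/funext.
have dV : is_derive t 1 (fun s : R => s^-1) (- (t ^- 2) *: 1).
  exact: (@is_deriveV R id t 1 1 tn).
by apply: is_derive_eq; rewrite /GRing.scale /= mulr1 mulrN.
Qed.

(** An Oleinik estimate, with the constant [A] in place of a singularity of the
    bound at the initial time. *)
Lemma one_sided_lipschitz (R : realType) (f u0 : R -> R) u :
  smooth f -> (forall r, 0 < f^`(2)%classic r) -> solution_from f u0 u ->
  exists A k : R, [/\ 0 < A, 0 < k & forall t x y : R, 1 <= t -> y <= x ->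
    u t x - u t y <= (A + k * (x - y)) / t].
Proof.
move=> fs fconv us; have [sol _ _ _] := us.
have [M M0 uM] := solution_uniformly_bounded fs us.
have [m m0 fm] := continuous_gt0_ball M (smooth_continuous (n := 2) fs) fconv.
have [K fK] := continuous_bounded_ball M (smooth_continuous (n := 1) fs).
exists (2 * M), m^-1; split; [by rewrite mulr_gt0|by rewrite invr_gt0|].
move=> T x0 y0 T1 xy0.
have uB : strip_bounded T M u by move=> s y /andP[s1 _]; exact: uM.
have uNB : strip_bounded T M (fun s y => - u s y).
  by move=> s y st; rewrite normrN; exact: uB.
have bK : strip_bounded T K (fun s y => f^`()%classic (u s y)).
  by move=> s y st; apply: fK; exact: uB.
have adv := solution_advection_diffusion sol.
have uc := solution_jointly_continuous sol.
have uNc : jointly_continuous (fun s y => - u s y).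
  by move=> s y s0; apply: cvgN; exact: uc.
pose D : set (R * R) := [set p | p.2 <= p.1].
(* Strict convexity, quantified on the range of [u]. *)
have df_ge p q : p <= q -> `|p| <= M -> `|q| <= M ->
    m * (q - p) <= f^`()%classic q - f^`()%classic p.
  move=> pq pM qM.
  have [||z] := @MVT_segment R f^`()%classic f^`(2)%classic p q pq.
  - by move=> z _; apply: is_derive_derive1; exact: (fs 1%N z).
  - by apply: continuous_subspaceT; exact: (smooth_continuous (n := 1) fs).
  rewrite in_itv /= => /andP[pz zq] ->.
  apply: ler_wpM2r; first by rewrite subr_ge0.
  apply: fm; rewrite ler_norml.
  by move: pM qM; rewrite !ler_norml => /andP[? ?] /andP[? ?]; lra.
have psiE t r : 2 * M / t + m^-1 / t * r = (2 * M + m^-1 * r) / t.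
  by rewrite [RHS]mulrDl (mulrAC m^-1 r).
have psi_ge0 t r : 1 <= t -> 0 <= r -> 0 <= 2 * M / t + m^-1 / t * r.
  move=> t1 r0; have t0 : 0 < t by lra.
  apply: addr_ge0; first by rewrite divr_ge0 ?mulr_ge0 // ltW.
  by rewrite mulr_ge0 // divr_ge0 ?invr_ge0 // ltW.
rewrite -psiE.
apply: (@doubled_comparison R T K M _ _ u (fun s y => - u s y) D
  (fun t => 2 * M / t) (fun t => m^-1 / t) (fun t => - (2 * M / t ^+ 2))
  (fun t => - (m^-1 / t ^+ 2)) adv (advection_diffusionN adv)
  uc uNc uB uNB bK bK).
- have -> : D = (fun p : R * R => p.1 - p.2) @^-1` [set r | 0 <= r].
    by apply/seteqP; split => p; rewrite /D /= subr_ge0.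
  apply: preimage_closed; last exact: closed_ge.
  by move=> p _; apply: cvgB; [exact: cvg_fst|exact: cvg_snd].
- by move=> t t1; apply: is_derive_div_id; lra.
- by move=> t t1; apply: is_derive_div_id; lra.
- by move=> t x y /andP[t1 _] Dxy; apply: psi_ge0 => //; rewrite subr_ge0.
- move=> x y Dxy; rewrite !divr1.
  have := uM 1 x (lexx _); have := uM 1 y (lexx _).
  rewrite !ler_norml => /andP[? ?] /andP[? ?].
  have : 0 <= m^-1 * (x - y) by rewrite mulr_ge0 ?subr_ge0 // invr_ge0 ltW.
  by lra.
- move=> t x y /andP[t1 tT] Dxy above.
  have t0 : 0 < t by lra.
  have psi0 := psi_ge0 t (x - y) t1.
  (* On the diagonal [u t x - u t y] vanishes and cannot exceed the barrier. *)
  have xy : y < x.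
    rewrite lt_neqAle Dxy andbT; apply/eqP => e.
    by move: above psi0; rewrite -e subrr lexx => ? /(_ isT); lra.
  split.
    have : \forall p \near (x, y), 0 < p.1 - p.2.
      have : (fun p : R * R => p.1 - p.2) @ (x, y) --> x - y.
        by apply: cvgB; [exact: cvg_fst|exact: cvg_snd].
      by move/cvgr_gt; apply; rewrite subr_gt0.
    by apply: filterS => p; rewrite /D /= subr_gt0 => /ltW.
  have xy0' : 0 <= x - y by rewrite subr_ge0 ltW.
  have {}psi0 := psi0 xy0'.
  have fge := df_ge (u t y) (u t x) ltac:(lra) (uM t y t1) (uM t x t1).
  pose g := f^`()%classic (u t x) - f^`()%classic (u t y).
  have h1 : m * (2 * M / t + m^-1 / t * (x - y)) <= g.
    by apply: le_trans fge; rewrite ler_pM2l //; lra.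
  have k0 : 0 < m^-1 / t by rewrite divr_gt0 // invr_gt0.
  have := ler_wpM2r (ltW k0) h1.
  have mn : m != 0 by rewrite gt_eqF.
  have tn : t != 0 by rewrite gt_eqF.
  have -> : m * (2 * M / t + m^-1 / t * (x - y)) * (m^-1 / t) =
     2 * M / t ^+ 2 + m^-1 / t ^+ 2 * (x - y) by field; rewrite mn tn.
  by rewrite /g; lra.
- by rewrite T1 lexx.
- by [].
Qed.

(** * Flat windows and the limit *)

(** Otherwise the drops over adjacent windows would add up beyond [2 * M]. *)
Lemma bounded_small_drop (R : realType) (g : R -> R) (M L eps : R) :
  (forall x, `|g x| <= M) -> 0 < eps -> exists a, g a - g (a + L) <= eps.
Proof.
move=> gM eps0; apply: contrapT => /forallNP drop.
have {}drop a : g (a + L) < g a - eps.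
  by have /negP := drop a; rewrite -ltNge; lra.
have iter n : g (n%:R * L) <= g 0 - n%:R * eps.
  elim: n => [|n IH]; first by rewrite !mul0r subr0.
  have := drop (n%:R * L); rewrite -natr1 !mulrDl !mul1r.
  by move: IH; lra.
pose n := (Num.truncn (2 * M / eps)).+1.
have nM : 2 * M < n%:R * eps.
  by rewrite -ltr_pdivrMr //; exact: truncnS_gt.
have := iter n; have := gM 0; have := gM (n%:R * L).
rewrite !ler_norml => /andP[? ?] /andP[? ?].
by move: nM; lra.
Qed.

(** Between the ends [a] and [a + 2 L] of a window with small drop, [u t] can
    neither rise above its left value nor fall below its right value by more
    than the one-sided estimate allows. *)
Lemma flat_windows (R : realType) (f u0 : R -> R) u (L eps N : R) :
  smooth f -> (forall r, 0 < f^`(2)%classic r) -> solution_from f u0 u ->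
  0 <= L -> 0 < eps ->
  exists t z : R, [/\ 1 <= t, N <= t &
    forall x, `|x - z| <= L -> `|u t x - u t z| <= eps].
Proof.
move=> fs fconv us L0 eps0.
have [M M0 uM] := solution_uniformly_bounded fs us.
have [A [k [A0 k0 uAk]]] := one_sided_lipschitz fs fconv us.
(* From time [C] on, [u t] rises by at most [eps / 3] over a length [2 * L]. *)
pose C := (A + k * (2 * L)) / (eps / 3).
pose t := Num.max 1 (Num.max N C).
have t1 : 1 <= t by rewrite le_max lexx.
have tN : N <= t by rewrite !le_max lexx orbT.
have tC : C <= t by rewrite !le_max lexx !orbT.
have t0 : 0 < t by lra.
have e3 : 0 < eps / 3 by rewrite divr_gt0.
have [a drop] := bounded_small_drop (2 * L) (fun x => uM t x t1) e3.
have rise x y : y <= x -> x - y <= 2 * L -> u t x - u t y <= eps / 3.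
  move=> yx xyL; apply: le_trans (uAk t x y t1 yx) _.
  rewrite ler_pdivrMr // [leRHS]mulrC -ler_pdivrMr //.
  apply: le_trans _ tC.
  rewrite /C ler_pM2r ?invr_gt0 // lerD2l.
  by rewrite ler_pM2l.
exists t, (a + L); split => // x; rewrite ler_norml => /andP[x1 x2].
have := rise x a ltac:(lra) ltac:(lra).
have := rise (a + 2 * L) x ltac:(lra) ltac:(lra).
have := rise (a + L) a ltac:(lra) ltac:(lra).
have := rise (a + 2 * L) (a + L) ltac:(lra) ltac:(lra).
by rewrite ler_norml; lra.
Qed.

Lemma in_Linfty_cst (R : realType) (c : R) : in_Linfty (cst c).
Proof.
rewrite /in_Linfty inE; apply/andP; split; rewrite inE //=.
rewrite /finite_norm unlock /Lnorm lebesgue_setT_gt0.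
rewrite (_ : abse \o _ = cst (`|c|%:E)) //.
by rewrite ess_sup_cst ?lebesgue_setT_gt0 // ltry.
Qed.

Theorem corollary3p4 (R : realType) (f : R -> R)
    (f_smooth : smooth f) (f_convex : forall r : R, 0 < f^`(2)%classic r)
    (u0 : R -> R) (u0_Linfty : in_Linfty u0)
    (u : R -> R -> R) (u_sol : solution_from f u0 u) :
  exists2 v : R -> R, omega_limit u v & constant_state v \/ viscous_shock f v.
Proof.
have [M M0 uM] := solution_uniformly_bounded f_smooth u_sol.
have window n : exists p : R * R, [/\ 1 <= p.1, n%:R <= p.1 & forall x,
    `|x - p.2| <= n%:R -> `|u p.1 x - u p.1 p.2| <= n.+1%:R^-1].
  have [//||t [z [t1 tn tz]]] := @flat_windows R f u0 u n%:R n.+1%:R^-1 n%:R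
    f_smooth f_convex u_sol.
    by rewrite invr_gt0.
  by exists (t, z).
have [p pP] := choice window.
pose c_ n := u (p n).1 (p n).2.
have bc : bounded_fun c_.
  exists M; split; first exact: num_real.
  move=> r Mr n _; apply: le_trans (ltW Mr).
  by apply: uM; have [] := pP n.
have [s s_incr s_cvg] := bolzano_weierstrass bc.
have s_ge n : (n <= s n)%N.
  elim: n => // n IH; apply: leq_ltn_trans IH _.
  by move/increasing_seqP: s_incr => /(_ n); rewrite ltEnat.
have s_geR n : n%:R <= (s n)%:R :> R by rewrite ler_nat.
set c := lim (c_ \o s @ \oo) in s_cvg.
exists (cst c); last by left; exists c.
split; first exact: in_Linfty_cst.
exists (fun n => (p (s n)).1), (fun n => - (p (s n)).2); split.
  apply/cvgryPge => r; near=> n.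
  have [_ sp _] := pP (s n).
  apply: le_trans sp; apply: le_trans (s_geR n).
  by near: n; exact: nbhs_infty_ger.
move=> a b P /uniform_nbhs[E [entE EP]].
move: entE; rewrite -entourage_ballE => -[e /= e0 eE].
have e2 : 0 < e / 2 by rewrite divr_gt0.
have close : \forall n \near \oo, `|c - c_ (s n)| < e / 2.
  by move/cvgrPdist_lt: s_cvg; exact.
have long : \forall n \near \oo, `|a| + `|b| <= n%:R by exact: nbhs_infty_ger.
have fine : \forall n \near \oo, (e / 2)^-1 <= n%:R by exact: nbhs_infty_ger.
near=> n; apply: EP => /= x; rewrite in_itv /= => /andP[ax xb]; apply: eE.
rewrite /ball /= /translate opprK.
have [_ _ /(_ (x + (p (s n)).2))] := pP (s n).
rewrite addrK => win.
have xab : `|x| <= `|a| + `|b|.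
  have := ler_norm b; have := ler_norm (- a); rewrite normrN ler_norml.
  have := normr_ge0 a; have := normr_ge0 b; lra.
have nlong : `|a| + `|b| <= n%:R by near: n.
have nfine : (e / 2)^-1 <= n%:R by near: n.
have nclose : `|c - c_ (s n)| < e / 2 by near: n.
have {}win := win (le_trans xab (le_trans nlong (s_geR n))).
have small : (s n).+1%:R^-1 <= e / 2.
  rewrite invf_ple ?posrE //; apply: le_trans nfine _.
  by apply: le_trans (s_geR n) _; rewrite ler_nat.
have := ler_distD (c_ (s n)) c (u (p (s n)).1 (x + (p (s n)).2)).
rewrite (distrC (c_ (s n))) => /le_lt_trans; apply.
by rewrite [ltRHS]splitr ltr_leD //; exact: le_trans win small.
Unshelve. all: by end_near. Qed.
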